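(* Let $\chi=(P,Q,R)$ be a cubic vector field in $\mathbb{R}^3$. Then $\chi$ is a vector field on $\mathbb{T}^2$ if and only if there exist $f,K'\in\mathbb{R}[x,y,z]$ and $\beta,\gamma\in\mathbb{R}$ such that $$P=\tfrac14 Kx+fy+\beta z,\qquad Q=\tfrac14 Ky-fx+\gamma z,$$ $$R=\tfrac12 K'\big(-a^2(x^2+y^2)+z^2+a^4-1\big)-2(\beta x+\gamma y)(x^2+y^2-a^2),$$ where $K=K'z$ and $\deg f,\deg K\leq 2$. Moreover, $K$ is the cofactor of $\chi$ for $\mathbb{T}^2$.
   Context: Fix a real number $a>1$ and let $\mathbb{T}^2=\{(x,y,z)\in\mathbb{R}^3:(x^2+y^2-a^2)^2+z^2-1=0\}$. A triple $\chi=(P,Q,R)$ with $P,Q,R\in\mathbb{R}[x,y,z]$ denotes the polynomial vector field $P\frac{\partial}{\partial x}+Q\frac{\partial}{\partial y}+R\frac{\partial}{\partial z}$ in $\mathbb{R}^3$, acting on polynomials as a derivation; its degree is $\max\{\deg P,\deg Q,\deg R\}$, and it is cubic if its degree is $3$. It is called a vector field on $\mathbb{T}^2$ if $\chi F=KF$ for some $K\in\mathbb{R}[x,y,z]$, where $F=(x^2+y^2-a^2)^2+z^2-1$; the polynomial $K$ is then called the cofactor of $\chi$ for $\mathbb{T}^2$. *)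

(* Defs.v *)
From HB Require Import structures.
From mathcomp Require Import all_boot all_order all_algebra.
From mathcomp Require Import reals.
From mathcomp Require Import mpoly.

Set Implicit Arguments.
Unset Strict Implicit.
Unset Printing Implicit Defensive.

Import GRing.Theory Num.Theory.
Local Open Scope ring_scope.

Section TorusVectorFields.
Variable R : realType.

Definition varx : {mpoly R[3]} := 'X_(inord 0).
Definition vary : {mpoly R[3]} := 'X_(inord 1).
Definition varz : {mpoly R[3]} := 'X_(inord 2).

(* Total degree, with the convention that the zero polynomial has degree 0. *)
Definition mdegree (p : {mpoly R[3]}) : nat := (msize p).-1.

Record polyVF := PolyVF {
  compP : {mpoly R[3]};
  compQ : {mpoly R[3]};
  compR : {mpoly R[3]} }.

Definition vf_apply (chi : polyVF) (G : {mpoly R[3]}) : {mpoly R[3]} :=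
  compP chi * G^`M(inord 0) + compQ chi * G^`M(inord 1)
  + compR chi * G^`M(inord 2).

Definition vf_degree (chi : polyVF) : nat :=
  maxn (mdegree (compP chi)) (maxn (mdegree (compQ chi)) (mdegree (compR chi))).

Definition cubic (chi : polyVF) : Prop := vf_degree chi = 3%N.

Definition torusF (a : R) : {mpoly R[3]} :=
  (varx ^+ 2 + vary ^+ 2 - (a ^+ 2)%:MP) ^+ 2 + varz ^+ 2 - 1.

Definition is_cofactor (a : R) (chi : polyVF) (K : {mpoly R[3]}) : Prop :=
  vf_apply chi (torusF a) = K * torusF a.

Definition vf_on_torus (a : R) (chi : polyVF) : Prop :=
  exists K : {mpoly R[3]}, is_cofactor a chi K.

Definition torus_normal_form (a : R) (chi : polyVF)
    (f K K' : {mpoly R[3]}) (beta gamma : R) : Prop :=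
  [/\ K = K' * varz,
      (mdegree f <= 2)%N /\ (mdegree K <= 2)%N,
      compP chi = 4^-1 *: (K * varx) + f * vary + beta *: varz,
      compQ chi = 4^-1 *: (K * vary) - f * varx + gamma *: varz
    & compR chi =
        2^-1 *: (K' * (- (a ^+ 2 *: (varx ^+ 2 + vary ^+ 2)) + varz ^+ 2
                       + (a ^+ 4 - 1)%:MP))
        - 2 *: ((beta *: varx + gamma *: vary)
                   * (varx ^+ 2 + vary ^+ 2 - (a ^+ 2)%:MP)) ].

End TorusVectorFields.

(* Main.v *)
(** Write [A = x^2 + y^2 - a^2], so that [F = A^2 + z^2 - 1] and a cofactor
    satisfies [K F = 4 A (x P + y Q) + 2 z R].  Modulo [z] this forces [A] to
    divide [K]; for degree reasons and since [a^4 != 1], [z] divides [K] and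
    [x P + y Q] vanishes modulo [z], so [(P, Q)] is [f0 (y, -x) + z (P1, Q1)].
    Dividing the identity by [z] shows that [A (K' A - 4 (x P1 + y Q1))] has
    degree at most 3.  Hence [K' (x^2 + y^2) - 4 (x P1 + y Q1)] is affine, and
    as it vanishes on the [z]-axis it is a linear form in [x] and [y], whose
    coefficients are [-4 beta] and [-4 gamma]; the relation between [P1] and
    [Q1] thus obtained is again solved by a multiple of [(y, -x)]. *)
From HB Require Import structures.
Require Import Defs.
From mathcomp Require Import all_boot all_order all_algebra.
From mathcomp Require Import reals.
From mathcomp Require Import mpoly.
From mathcomp Require Import ring.

Set Implicit Arguments.
Unset Strict Implicit.
Unset Printing Implicit Defensive.

Import Order.TTheory GRing.Theory Num.Theory.
Local Open Scope ring_scope.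

(** * Reduction modulo a variable *)

Section SetVariableToZero.
Variables (n : nat) (R : comNzRingType).
Implicit Types (i : 'I_n) (p : {mpoly R[n]}).

(** Reduction modulo ['X_i] is kept as an endomorphism of the same ring, so that a residue can be
    subtracted from [p] and reductions in different variables compose. *)
Definition subst0 i p : {mpoly R[n]} :=
  p \mPo [tuple (if j == i then 0 else 'X_j) | j < n].

HB.instance Definition _ i := GRing.RMorphism.copy (subst0 i)
  (comp_mpoly [tuple (if j == i then 0 else 'X_j) | j < n]).

Lemma subst0C i c : subst0 i c%:MP = c%:MP.
Proof. exact: comp_mpolyC. Qed.

Lemma subst0Z i c p : subst0 i (c *: p) = c *: subst0 i p.
Proof. exact: comp_mpolyZ. Qed.

Lemma subst0XU i j : subst0 i 'X_j = if j == i then 0 else 'X_j.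
Proof. by rewrite /subst0 comp_mpolyXU -tnth_nth tnth_mktuple. Qed.

Lemma subst0XX i m : subst0 i 'X_[m] = if m i == 0%N then 'X_[m] else 0.
Proof.
rewrite /subst0 comp_mpolyX; case: eqP => [mi0|/eqP mi_neq0].
  rewrite [RHS]mpolyXE_id; apply: eq_bigr => j _.
  rewrite tnth_mktuple; case: eqP => // ->; by rewrite mi0 !expr0.
by rewrite (bigD1 i) //= tnth_mktuple eqxx expr0n (negPf mi_neq0) mul0r.
Qed.

(** By linearity it suffices to treat a monomial, which is either free of ['X_i] and fixed, or
    divisible by ['X_i] and killed. *)
Lemma subst0_divX i p : exists q, p = subst0 i p + 'X_i * q.
Proof.
elim/mpolyind: p => [|c m p _ _ [q Eq]].
  by exists 0; rewrite rmorph0 mulr0 addr0.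
rewrite rmorphD /= subst0Z subst0XX {1}Eq.
case: eqP => [_|/eqP mi_neq0]; first by exists q; rewrite addrA.
exists (c *: 'X_[m - U_(i)] + q).
rewrite scaler0 add0r mulrDr addrCA -scalerAr -mpolyXD addmC submK //.
by rewrite lep1mP.
Qed.

Lemma msize_subst0 i p : (msize (subst0 i p) <= msize p)%N.
Proof.
rewrite {1}[p]mpolyE rmorph_sum; apply: leq_trans (msize_sum _ _ _) _.
rewrite big_seq; elim/big_ind: _ => // [k l|m mp].
  by rewrite geq_max => ->.
rewrite /= subst0Z (leq_trans (msizeZ_le _ _)) // subst0XX.
by case: ifP => _; rewrite ?msizeX ?msize0 // msize_mdeg_lt.
Qed.

Lemma subst0_eq0 i p : subst0 i p = 0 -> exists q, p = 'X_i * q.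
Proof. by case: (subst0_divX i p) => q {2}-> ->; exists q; rewrite add0r. Qed.

Lemma mderivXU i j : ('X_j : {mpoly R[n]})^`M(i) = (j == i)%:R.
Proof.
rewrite mderivX mnm1E; case: eqP => [->|_]; last by rewrite scale0r.
by rewrite -{1}[U_(i)%MM]add0m addmK mpolyX0 scale1r.
Qed.

Lemma msizeXn i k : msize ('X_i ^+ k : {mpoly R[n]}) = k.+1.
Proof. by rewrite mpolyXn msizeX mdegMn mdeg1 mul1n. Qed.

End SetVariableToZero.

(** * Degree bounds, with [msize] the total degree plus one *)

Section Degrees.
Variables (n : nat) (R : idomainType).
Implicit Types (p q : {mpoly R[n]}) (d k : nat).

Lemma msizeD_leq p q k : (msize p <= k -> msize q <= k -> msize (p + q) <= k)%N.
Proof. by move=> pk qk; rewrite (leq_trans (msizeD_le _ _)) // geq_max pk. Qed.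

Lemma msizeB_leq p q k : (msize p <= k -> msize q <= k -> msize (p - q) <= k)%N.
Proof. by move=> pk qk; rewrite msizeD_leq ?msizeN. Qed.

Lemma msizeM_leq p q d k :
  (msize p <= d.+1 -> msize q <= k.+1 -> msize (p * q) <= (d + k).+1)%N.
Proof.
have [->|p0] := eqVneq p 0; first by rewrite mul0r msize0.
have [->|q0] := eqVneq q 0; first by rewrite mulr0 msize0.
move=> pd qk; rewrite msizeM //; apply: leq_trans (_ : (d.+1 + k.+1).-1 <= _)%N.
  by rewrite -!subn1 leq_sub2r // leq_add.
by rewrite addnS addSn.
Qed.

Lemma msizeC_leq1 (c : R) : (msize (c%:MP : {mpoly R[n]}) <= 1)%N.
Proof. by rewrite msizeC leq_b1. Qed.

(** Degrees add over an integral domain. The strict bound says that [p] is nonzero of degree at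
    least [d], so [q] has degree less than [k] or is zero. *)
Lemma msize_factor_leq p q d k :
  (d < msize p -> msize (p * q) <= d + k -> msize q <= k)%N.
Proof.
have [->|q0] := eqVneq q 0; first by rewrite msize0.
move=> dp; have p0 : p != 0.
  by rewrite -msize_poly_eq0 -lt0n (leq_ltn_trans _ dp).
rewrite msizeM // -(prednK (leq_ltn_trans (leq0n d) dp)) addSn /= => pqk.
rewrite -(leq_add2l d) (leq_trans _ pqk) // leq_add2r -ltnS.
by rewrite (prednK (leq_ltn_trans _ dp)).
Qed.

End Degrees.

(** * The torus polynomial and the circle polynomial [A] *)

Section Torus.
Variables (R : realType) (a : R).
Local Notation x := (varx R).
Local Notation y := (vary R).
Local Notation z := (varz R).
Local Notation sx := (@subst0 3 R (inord 0)).
Local Notation sy := (@subst0 3 R (inord 1)).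
Local Notation sz := (@subst0 3 R (inord 2)).
Local Notation A := (x ^+ 2 + y ^+ 2 - (a ^+ 2)%:MP).

Lemma inord3_eq (i j : nat) : (i < 3)%N -> (j < 3)%N ->
  (inord i == inord j :> 'I_3) = (i == j).
Proof. by move=> i3 j3; rewrite -val_eqE /= !inordK. Qed.

Lemma subst0_coord :
  [/\ [/\ sx x = 0, sx y = y & sx z = z],
      [/\ sy x = x, sy y = 0 & sy z = z]
    & [/\ sz x = x, sz y = y & sz z = 0]].
Proof. by rewrite !subst0XU !inord3_eq. Qed.

Lemma msize_coord : [/\ msize x = 2%N, msize y = 2%N & msize z = 2%N].
Proof. by rewrite !msizeX !mdeg1. Qed.

Lemma coord_neq0 : [/\ x != 0, y != 0 & z != 0].
Proof. by case: msize_coord; rewrite -!msize_poly_eq0 => -> -> ->. Qed.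

Lemma vf_apply_torusF chi : vf_apply chi (torusF a) =
  4 * A * (x * compP chi + y * compQ chi) + 2 * z * compR chi.
Proof.
rewrite /vf_apply /torusF -mpolyC1 !expr2 !(mderivB, mderivD, mderivM, mderivC).
rewrite !mderivXU !inord3_eq //=.
ring.
Qed.

Lemma subst0_circle :
  [/\ sz A = A, sy A = x ^+ 2 - (a ^+ 2)%:MP
    & sx (sy A) = - (a ^+ 2)%:MP].
Proof.
case: subst0_coord => [[sxx _ _] [syx syy _] [szx szy _]].
have syA : sy A = x ^+ 2 - (a ^+ 2)%:MP.
  by rewrite !(rmorphB, rmorphD, rmorphXn) /= subst0C syx syy expr0n addr0.
split=> //; first by rewrite !(rmorphB, rmorphD, rmorphXn) /= subst0C szx szy.
by rewrite syA rmorphB rmorphXn /= subst0C sxx expr0n sub0r.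
Qed.

(** Setting [y = 0] does not raise the degree and leaves [x ^+ 2] plus a constant. *)
Lemma msize_circle_gt2 : (2 < msize A)%N.
Proof.
rewrite ltnNge; apply/negP => le_A.
have [_ syA _] := subst0_circle.
suff: (msize (x ^+ 2) <= 2)%N by rewrite msizeXn.
rewrite (_ : x ^+ 2 = sy A + (a ^+ 2)%:MP); last by rewrite syA subrK.
apply: msizeD_leq; last exact: leq_trans (msizeC_leq1 _ _) _.
exact: leq_trans (msize_subst0 _ _) _.
Qed.

(** Setting [y = z = 0] leaves a quartic in [x] with leading term [x ^+ 4]. *)
Lemma msize_torusF_gt4 : (4 < msize (torusF a))%N.
Proof.
rewrite ltnNge; apply/negP => le_F.
have [[_ _ _] [syx syy syz] [szx szy szz]] := subst0_coord.
have [szA syA _] := subst0_circle.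
suff: (msize (x ^+ 4) <= 4)%N by rewrite msizeXn.
have -> : x ^+ 4 = sy (sz (torusF a))
    + ((2 * a ^+ 2)%:MP * x ^+ 2 - (a ^+ 4 - 1)%:MP).
  have -> : sz (torusF a) = A ^+ 2 - 1.
    rewrite rmorphB rmorphD (rmorphXn sz) /= szA (rmorphXn sz) /= szz.
    by rewrite rmorph1 expr0n addr0.
  by rewrite rmorphB (rmorphXn sy) /= syA rmorph1; ring.
apply: msizeD_leq.
  by do 2![apply: leq_trans (msize_subst0 _ _) _].
apply: msizeB_leq; last exact: leq_trans (msizeC_leq1 _ _) _.
apply: (@msizeM_leq _ _ _ _ 0 3); first exact: msizeC_leq1.
by rewrite msizeXn.
Qed.

(** * A normal form determines the cofactor *)

(** This relation lets later ring computations treat the constant [4^-1] as a symbol [q] with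
    [4 * q = 1]. *)
Lemma quarter_mpoly : 4 * (4^-1)%:MP = 1 :> {mpoly R[3]}.
Proof. by rewrite -(mpolyC_nat 3 R 4) -mpolyCM mulfV ?mpolyC1 // pnatr_eq0. Qed.

Lemma half_mpoly : (2^-1)%:MP = 2 * (4^-1)%:MP :> {mpoly R[3]}.
Proof. by rewrite -(mpolyC_nat 3 R 2) -mpolyCM; congr (_%:MP); field. Qed.

Lemma normal_form_cofactor chi f K K' beta gamma :
  torus_normal_form a chi f K K' beta gamma -> is_cofactor a chi K.
Proof.
case=> -> _ eP eQ eR; rewrite /is_cofactor vf_apply_torusF eP eQ eR /torusF.
rewrite -!mul_mpolyC.
have h4 := quarter_mpoly; rewrite half_mpoly.
move: (4^-1)%:MP h4 => q h4.
apply/eqP; rewrite -subr_eq0; apply/eqP.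
(* The terms in [f], [beta] and [gamma] cancel. Since [A * (x ^+ 2 + y ^+ 2) + W] is the torus
   polynomial, what remains is a multiple of [4 * q - 1]. *)
pose W := - ((a ^+ 2)%:MP * (x ^+ 2 + y ^+ 2)) + z ^+ 2 + (a ^+ 4 - 1)%:MP.
transitivity ((4 * q - 1) * (K' * z * (A * (x ^+ 2 + y ^+ 2) + W))).
  by rewrite /W; ring.
by rewrite h4 subrr mul0r.
Qed.

Lemma cofactor_unique chi K L :
  is_cofactor a chi K -> is_cofactor a chi L -> K = L.
Proof.
rewrite /is_cofactor => -> /mulIf; apply.
by rewrite -msize_poly_eq0 -lt0n (leq_ltn_trans _ msize_torusF_gt4).
Qed.

(** * Syzygies and linear forms in [x] and [y] *)

(** Setting [y = 0] shows that [y] divides [p]; cancelling [y] in the relation then gives [q]. *)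
Lemma xy_syzygy (p q : {mpoly R[3]}) :
  x * p + y * q = 0 -> exists f, p = y * f /\ q = - (x * f).
Proof.
case: subst0_coord coord_neq0 => [_ [syx syy _] _] [x0 y0 _] eq0.
have /eqP: sy (x * p + y * q) = 0 by rewrite eq0 rmorph0.
rewrite rmorphD !(rmorphM sy) /= syx syy mul0r addr0 mulf_eq0 (negPf x0) /=.
move/eqP/subst0_eq0 => [f ef]; exists f; split=> //.
apply: (mulfI y0); apply/eqP; rewrite -subr_eq0 -eq0 ef /vary.
apply/eqP; ring.
Qed.

(** Dividing by [y] and then by [x] leaves no remainder, as [l] vanishes on the [z]-axis; both
    quotients are constant by degree. *)
Lemma xy_linear_form (l : {mpoly R[3]}) : (msize l <= 2)%N -> sx (sy l) = 0 ->
  exists b c : R, l = b *: x + c *: y.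
Proof.
move=> ltl /subst0_eq0 [u eu]; have [v ev] := subst0_divX (inord 1) l.
have [sx2 sy2 _] := msize_coord.
have syl : (msize (sy l) <= 2)%N := leq_trans (msize_subst0 _ _) ltl.
have /msize1_polyC eu' : (msize u <= 1)%N.
  by apply: (@msize_factor_leq _ _ x u 1); rewrite ?sx2 // -eu.
have /msize1_polyC ev' : (msize v <= 1)%N.
  apply: (@msize_factor_leq _ _ y v 1); rewrite ?sy2 //.
  by rewrite (_ : y * v = l - sy l) ?msizeB_leq // {1}ev addrC addKr.
exists u@_0, v@_0; rewrite ev eu {1}eu' {1}ev'.
by rewrite -!mul_mpolyC; congr (_ + _); rewrite mulrC.
Qed.

(** * The cofactor: degree and reduction modulo [z] *)

(** A field of degree 3 sends the quartic torus polynomial to degree at most 6, which leaves at most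
    2 for [K]. *)
Lemma cofactor_msize chi K : vf_degree chi = 3%N -> is_cofactor a chi K ->
  [/\ (msize K <= 3)%N, (msize (compP chi) <= 4)%N, (msize (compQ chi) <= 4)%N
    & (msize (compR chi) <= 4)%N].
Proof.
move=> deg3 cofK.
have deg4 p : (mdegree p <= 3)%N -> (msize p <= 4)%N.
  by rewrite /mdegree; case: (msize p).
have [P4 Q4 R4] : [/\ (msize (compP chi) <= 4)%N, (msize (compQ chi) <= 4)%N
    & (msize (compR chi) <= 4)%N].
  by split; apply: deg4; rewrite -deg3 /vf_degree !leq_max leqnn ?orbT.
split=> //; have [sx2 sy2 sz2] := msize_coord.
apply: (@msize_factor_leq _ _ (torusF a) K 4); first exact: msize_torusF_gt4.
rewrite mulrC -cofK vf_apply_torusF -!(mpolyC_nat 3).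
have A3 : (msize A <= 3)%N.
  rewrite !(msizeB_leq, msizeD_leq) // ?msizeXn //.
  exact: leq_trans (msizeC_leq1 _ _) _.
apply: msizeD_leq.
  apply: (@msizeM_leq _ _ _ _ 2 4).
    by apply: (@msizeM_leq _ _ _ _ 0 2) => //; apply: msizeC_leq1.
  by apply: msizeD_leq; apply: (@msizeM_leq _ _ _ _ 1 3); rewrite ?sx2 ?sy2.
apply: (@leq_trans 5) => //.
apply: (@msizeM_leq _ _ _ _ 1 3) => //.
by apply: (@msizeM_leq _ _ _ _ 0 1); rewrite ?sz2 ?msizeC_leq1.
Qed.

Lemma cofactor_mod_z chi K : is_cofactor a chi K ->
  sz K * (A ^+ 2 - 1) = 4 * A * (x * sz (compP chi) + y * sz (compQ chi)).
Proof.
move=> cofK; have [_ _ [szx szy szz]] := subst0_coord.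
have [szA _ _] := subst0_circle.
have := congr1 sz cofK; rewrite vf_apply_torusF [in RHS](rmorphM sz) /= => e.
have : sz K * sz (torusF a)
    = 4 * A * (x * sz (compP chi) + y * sz (compQ chi)).
  rewrite -e rmorphD /= !(rmorphM sz) /= szz mulr0 mul0r addr0.
  rewrite szA rmorph_nat; congr (_ * _).
  by rewrite rmorphD !(rmorphM sz) /= szx szy.
rewrite rmorphB rmorphD (rmorphXn sz) /= szA (rmorphXn sz) /= szz rmorph1.
by rewrite expr0n addr0.
Qed.

Lemma circle_neq0 : A != 0.
Proof. by rewrite -msize_poly_eq0 -lt0n (leq_ltn_trans _ msize_circle_gt2). Qed.

(* Modulo [z] the cofactor is divisible by [A], hence a constant multiple of
   it; evaluating on the [z]-axis then kills the constant since [a ^ 4 != 1]. *)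
Lemma cofactor_mod_z_eq0 chi K : 1 < a -> (msize K <= 3)%N ->
  is_cofactor a chi K -> sz K = 0.
Proof.
move=> a_gt1 K3 /cofactor_mod_z.
have [[sxx _ _] [syx syy _] _] := subst0_coord.
have [_ _ sxA] := subst0_circle.
set p := x * _ + y * _ => eK.
(* The identity [eK] rearranges to [sz K = A * (sz K * A - 4 * p)], which exhibits the quotient. *)
pose c := sz K * A - 4 * p.
have eKA : sz K = A * c.
  apply/eqP; rewrite -subr_eq0; apply/eqP.
  transitivity (4 * A * p - sz K * (A ^+ 2 - 1)); first by rewrite /c; ring.
  by rewrite eK subrr.
have /msize1_polyC ec : (msize c <= 1)%N.
  apply: (@msize_factor_leq _ _ A c 2); first exact: msize_circle_gt2.
  by rewrite -eKA (leq_trans (msize_subst0 _ _)).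
have ecA : c * (A ^+ 2 - 1) = 4 * p.
  by apply: (mulfI circle_neq0); rewrite mulrA -eKA eK; ring.
have p0 : sx (sy p) = 0.
  rewrite /p (rmorphD sy) !(rmorphM sy) /= syx syy mul0r addr0.
  by rewrite (rmorphM sx) /= sxx mul0r.
have A1 : sx (sy (A ^+ 2 - 1)) = (a ^+ 4 - 1)%:MP.
  rewrite (rmorphB sy) (rmorphXn sy) (rmorphB sx) (rmorphXn sx) /= sxA !rmorph1.
  by ring.
have : sx (sy (c * (A ^+ 2 - 1))) = 0.
  by rewrite ecA (rmorphM sy) (rmorphM sx) /= p0 mulr0.
rewrite (rmorphM sy) (rmorphM sx) /= A1 ec !subst0C -mpolyCM.
move/eqP; rewrite mpolyC_eq0 mulf_eq0 => /orP[/eqP c0|].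
  by rewrite eKA ec c0 mpolyC0 mulr0.
by rewrite subr_eq0 pexpr_eq1 // ?gt_eqF // ltW // (lt_trans ltr01).
Qed.

(** * Construction of the normal form from a cofactor *)

Lemma cofactor_normal_form chi K : 1 < a -> cubic chi -> is_cofactor a chi K ->
  exists (f K K' : {mpoly R[3]}) (beta gamma : R),
    torus_normal_form a chi f K K' beta gamma.
Proof.
move=> a_gt1 cub cofK; have [K3 P4 Q4 R4] := cofactor_msize cub cofK.
have szK := cofactor_mod_z_eq0 a_gt1 K3 cofK.
have [x0 y0 z0] := coord_neq0; have [sx2 sy2 sz2] := msize_coord.
have := cofactor_mod_z cofK; rewrite szK mul0r => /esym/eqP.
have /negPf n4 : (4 : {mpoly R[3]}) != 0.
  by rewrite -(mpolyC_nat 3 R 4) mpolyC_eq0 pnatr_eq0.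
rewrite mulf_eq0 mulf_eq0 n4 (negPf circle_neq0) /=.
move/eqP/xy_syzygy => [f0 [ef0P ef0Q]].
have [P1 eP] := subst0_divX (inord 2) (compP chi).
have [Q1 eQ] := subst0_divX (inord 2) (compQ chi).
have [K' eK] := subst0_eq0 szK.
rewrite ef0P in eP; rewrite ef0Q in eQ.
have K'2 : (msize K' <= 2)%N.
  by apply: (@msize_factor_leq _ _ z K' 1); rewrite ?sz2 // -eK.
have h4 := quarter_mpoly; have h2 := half_mpoly.
(* The [f0] terms cancel in [x * P + y * Q], so the cofactor identity is divisible by [z]; the
   quotient expresses [A * h] with degree at most 3. *)
pose h := K' * A - 4 * (x * P1 + y * Q1).
have eA : A * h = 2 * compR chi - K' * (z ^+ 2 - 1).
  apply: (mulfI z0); apply/eqP; rewrite -subr_eq0; apply/eqP.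
  transitivity (K * torusF a - vf_apply chi (torusF a)).
    by rewrite vf_apply_torusF eP eQ eK /torusF /h /varz; ring.
  by rewrite cofK subrr.
have h_le2 : (msize h <= 2)%N.
  apply: (@msize_factor_leq _ _ A h 2); first exact: msize_circle_gt2.
  rewrite eA -(mpolyC_nat 3 R 2) msizeB_leq //.
    by apply: (@msizeM_leq _ _ _ _ 0 3); rewrite ?msizeC_leq1.
  apply: (@msizeM_leq _ _ _ _ 1 2) => //.
  by rewrite msizeB_leq ?msizeXn // msize1.
(* Adding [a ^+ 2] times the affine [K'] to [h] keeps it affine and removes the part that survives
   on the [z]-axis. *)
pose l := K' * (x ^+ 2 + y ^+ 2) - 4 * (x * P1 + y * Q1).
have el : l = h + (a ^+ 2)%:MP * K' by rewrite /l /h; ring.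
have l2 : (msize l <= 2)%N.
  rewrite el msizeD_leq //.
  by apply: (@msizeM_leq _ _ _ _ 0 1); rewrite ?msizeC_leq1.
have sl0 : sx (sy l) = 0.
  have [[sxx _ _] [syx syy _] _] := subst0_coord.
  have -> : l = x * (K' * x - 4 * P1) + y * (K' * y - 4 * Q1).
    by rewrite /l; ring.
  rewrite (rmorphD sy) !(rmorphM sy) /= syx syy mul0r addr0.
  by rewrite (rmorphM sx) /= sxx mul0r.
have [b [c ebc]] := xy_linear_form l2 sl0.
set q : {mpoly R[3]} := (4^-1)%:MP in h4 h2.
rewrite -!mul_mpolyC in ebc.
(* Subtracting the particular solution [q * (K' * x - b)], [q * (K' * y - c)] of the relation [ebc]
   leaves a homogeneous relation. *)
have /xy_syzygy [f1 [ef1P ef1Q]] :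
    x * (P1 - q * K' * x + q * b%:MP) + y * (Q1 - q * K' * y + q * c%:MP) = 0.
  transitivity ((1 - 4 * q) * (x * P1 + y * Q1)
    - q * (l - (b%:MP * x + c%:MP * y))); first by rewrite /l; ring.
  by rewrite h4 ebc !subrr mul0r mulr0 subr0.
have eP1 : P1 = y * f1 + q * K' * x - q * b%:MP by rewrite -ef1P; ring.
have eQ1 : Q1 = - (x * f1) + q * K' * y - q * c%:MP by rewrite -ef1Q; ring.
have eqM d : (- (4^-1 * d))%:MP = - (q * d%:MP) :> {mpoly R[3]}.
  by rewrite mpolyCN mpolyCM.
have P_form : compP chi = 4^-1 *: (K * x) + (f0 + z * f1) * y
    + (- (4^-1 * b)) *: z.
  rewrite -!mul_mpolyC -/q eqM eP eP1 eK /varz; ring.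
(* The two syzygy multipliers combine into [f], since [P1] and [Q1] enter with a factor [z]; [K] is
   the given cofactor. *)
exists (f0 + z * f1), K, K', (- (4^-1 * b)), (- (4^-1 * c)); split=> //.
- by rewrite eK mulrC.
- have deg2 p : (msize p <= 3)%N -> (mdegree p <= 2)%N.
    by rewrite /mdegree; case: (msize p).
  split; apply: deg2 => //.
  (* The degree of [f] is read off from [y * f], whose expression through [P] and [K] has degree at
     most 3. *)
  apply: (@msize_factor_leq _ _ y _ 1); rewrite ?sy2 //.
  have -> : y * (f0 + z * f1)
      = compP chi - 4^-1 *: (K * x) - (- (4^-1 * b)) *: z.
    by rewrite P_form; ring.
  rewrite !msizeB_leq // (leq_trans (msizeZ_le _ _)) ?sz2 //.
  by apply: (@msizeM_leq _ _ _ _ 2 1); rewrite ?sx2.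
- rewrite -!mul_mpolyC -/q eqM eQ eQ1 eK /varz; ring.
rewrite -!mul_mpolyC -/q !eqM h2 mpolyC_nat.
(* The third component is recovered by halving [eA], with [2 * q] standing for one half. *)
have eR : compR chi = 2 * q * (A * h + K' * (z ^+ 2 - 1)).
  transitivity (4 * q * compR chi); first by rewrite h4 mul1r.
  by rewrite eA; ring.
rewrite eR; have -> : h = b%:MP * x + c%:MP * y - (a ^+ 2)%:MP * K'.
  by rewrite -ebc el addrK.
ring.
Qed.

End Torus.

(* The second conjunct expresses "K is the cofactor": [unique] also records
   that no other polynomial is a cofactor of chi. *)
Theorem theorem2p1 (R : realType) (a : R) (ha : 1 < a) (chi : polyVF R)
    (hchi : cubic chi) :
  (vf_on_torus a chi <->
     exists (f K K' : {mpoly R[3]}) (beta gamma : R),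
       torus_normal_form a chi f K K' beta gamma)
  /\ (forall (f K K' : {mpoly R[3]}) (beta gamma : R),
        torus_normal_form a chi f K K' beta gamma ->
        unique (is_cofactor a chi) K).
Proof.
split.
  split; first by case=> K; apply: cofactor_normal_form.
  by case=> f [K] [K'] [b] [c] nf; exists K; apply: normal_form_cofactor nf.
move=> f K K' b c /normal_form_cofactor cofK.
by split=> // L; apply: cofactor_unique.
Qed.
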